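(* A countable group $G$ admits a non-discrete $T_1$ paratopological group topology if and only if there exists a non-trivial $PT$-sequence $\{a_n\}_{n\in\omega}$ of elements of $G$.
   Context: $G$ is not assumed Abelian; $e$ is its identity. A paratopological group topology on $G$ is a topology making multiplication jointly continuous. A sequence $\{a_n\}_{n\in\omega}$ in $G$ is a $PT$-sequence if there is a $T_1$ paratopological group topology on $G$ in which $\{a_n\}$ converges to $e$; it is non-trivial if $a_n\neq e$ for infinitely many $n$. *)

(* Defs.v *)
From HB Require Import structures.
From mathcomp Require Import all_boot.
From mathcomp Require Import all_classical.
From mathcomp Require Import topology.

Set Implicit Arguments.
Unset Strict Implicit.
Unset Printing Implicit Defensive.

Local Open Scope classical_set_scope.

(* A topology on T in terms of its open sets; the empty set is open as the
   union of the empty family. *)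
Definition topology_on (T : choiceType) :=
  isOpenTopological.axioms_ T (Choice.class T) (Choice.class T).

Definition topologize (T : choiceType) (t : topology_on T) : topologicalType :=
  let m : isOpenTopological.axioms_ T (Choice.class T) (Choice.class T) := t in
  HB.pack T m.

(* The library only has discreteness as a structure, not as a predicate. *)
Definition discrete_space (T : topologicalType) : Prop :=
  forall A : set T, open A.

(* Joint continuity, the domain carrying the product topology. *)
Definition paratopological (G : groupType) (t : topology_on G) : Prop :=
  continuous (fun p : topologize t * topologize t =>
    ((p.1 : G) * (p.2 : G))%g : topologize t).

Definition PT_sequence (G : groupType) (a : nat -> G) : Prop :=
  exists t : topology_on G,
    [/\ paratopological t,
        accessible_space (topologize t) (* T1 *) &
        (a : nat -> topologize t) @ \oo --> (1%g : topologize t)].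

Definition nontrivial_sequence (G : groupType) (a : nat -> G) : Prop :=
  infinite_set [set n | a n <> 1%g].

(* Main.v *)
(** The given topology need not be first countable, but since
[G] is countable one can pick, among the neighbourhoods of [1], a decreasing
sequence [U n] that is closed under halving ([U n.+1 * U n.+1 <= U n]), that
eventually absorbs conjugation by each element of [G], and whose intersection
is [{1}]. It is a base at [1] of a coarser [T1] paratopological topology, and
any choice of [a n] in [U n] other than [1], which exists as the original
topology is not discrete, converges to [1] for it. *)
Require Import Defs.
From HB Require Import structures.
From mathcomp Require Import all_boot.
From mathcomp Require Import all_classical.
From mathcomp Require Import topology.

Set Implicit Arguments.
Unset Strict Implicit.
Unset Printing Implicit Defensive.

Local Open Scope classical_set_scope.
Local Open Scope group_scope.

(** The axioms of a neighbourhood filter of [1] for a paratopological group topology. Inversion need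
    not be continuous, so nothing is asked of inverses; conjugation links left and right
    translates. *)
Record unit_filter (G : groupType) (F : set_system G) : Prop := UnitFilter {
  unit_filter_filter : Filter F;
  unit_filter1 : forall V, F V -> V 1;
  unit_filterM : forall V, F V ->
    exists2 W, F W & forall u v, W u -> W v -> V (u * v);
  unit_filterJ : forall V x, F V -> F [set u | V (u ^ x)] }.

Definition separated_filter (G : groupType) (F : set_system G) : Prop :=
  forall x, x <> 1 -> F [set u | u <> x].

Section ParatopologicalNbhs.
Variables (G : groupType) (t : topology_on G) (pt : paratopological t).

Lemma paratopological_nbhsM (x y : topologize t) (B : set G) :
  nbhs ((x * y : G) : topologize t) B ->
  exists V W : set G, [/\ nbhs x V, nbhs y W &
    forall u v, V u -> W v -> B (u * v)].
Proof.
move=> /(@pt (x, y)) [[V W] /= [nV nW] sVW].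
by exists V, W; split=> // u v Vu Wv; apply: (sVW (u, v)).
Qed.

Lemma paratopological_nbhs_translate (g x : G) (B : set G) :
  nbhs (g * x : topologize t) B ->
  nbhs (x : topologize t) [set u | B (g * u)].
Proof.
move=> /paratopological_nbhsM [V [W [nV nW sVW]]].
by apply: filterS nW => u Wu; apply: sVW => //; apply: nbhs_singleton nV.
Qed.

Lemma paratopological_nbhs_translater (g x : G) (B : set G) :
  nbhs (x * g : topologize t) B ->
  nbhs (x : topologize t) [set u | B (u * g)].
Proof.
move=> /paratopological_nbhsM [V [W [nV nW sVW]]].
by apply: filterS nV => u Vu; apply: sVW => //; apply: nbhs_singleton nW.
Qed.

Lemma nbhs1_unit_filter : unit_filter (nbhs (1 : topologize t)).
Proof.
split; first exact: (@nbhs_filter (topologize t) 1).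
- by move=> V; apply: nbhs_singleton.
- move=> V nV; have [|V1 [W1 [nV1 nW1 sV]]] := @paratopological_nbhsM 1 1 V.
    by rewrite mulg1.
  exists (V1 `&` W1); first exact: filterI.
  by move=> u v [Vu _] [_ Wv]; apply: sV.
- move=> V x nV.
  (* Conjugation by [x] is right translation by [x] followed by left translation by [x^-1]. *)
  apply: (@paratopological_nbhs_translater x 1 [set u | V (x^-1 * u)]).
  by apply: paratopological_nbhs_translate; rewrite mul1g mulVg.
Qed.

Lemma accessible_separated_filter :
  accessible_space (topologize t) ->
  separated_filter (nbhs (1 : topologize t)).
Proof.
move=> T1 x x1; have /T1[A [oA A1 Ax]] : (1 : topologize t) != x.
  by apply/eqP => /esym.
apply: (@filterS _ _ _ A); last by apply: open_nbhs_nbhs; rewrite inE in A1.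
by move=> u Au ux; rewrite inE in Ax; apply: Ax; rewrite -ux.
Qed.

Lemma nbhs1_set1_discrete :
  nbhs (1 : topologize t) [set 1] -> discrete_space (topologize t).
Proof.
move=> n1 A; rewrite openE => x Ax; rewrite /interior.
have: nbhs (x : topologize t) [set u | [set 1] (x^-1 * u)].
  by apply: paratopological_nbhs_translate; rewrite mulVg.
apply: filterS => u /(congr1 (fun w => x * w)).
by rewrite mulVKg mulg1 => ->.
Qed.

End ParatopologicalNbhs.

Section FilterTopology.
Variables (G : groupType) (F : set_system G) (uF : unit_filter F).

Let FF : Filter F := unit_filter_filter uF.
Local Existing Instance FF.

Let filter_open : set_system G :=
  [set A | forall x, A x -> F [set u | A (x * u)]].

Let filter_openT : filter_open [set: G].
Proof. by move=> x _; apply: filterT. Qed.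

Let filter_openI : setI_closed filter_open.
Proof. by move=> A B oA oB x [Ax Bx]; apply: filterI; [apply: oA|apply: oB]. Qed.

Let filter_open_bigU (I : Type) (f : I -> set G) :
  (forall i, filter_open (f i)) -> filter_open (\bigcup_i f i).
Proof.
move=> of_ x [i _ fix_]; apply: filterS (of_ i x fix_) => u fxu.
by exists i.
Qed.

Definition filter_topology : topology_on G :=
  isOpenTopological.Axioms_ filter_open filter_openT filter_openI
    filter_open_bigU.

(** The points [y] for which [B] contains [y * V] with [V] in [F] form an open set by
    [unit_filterM], and they lie in [B] by [unit_filter1]. *)
Lemma nbhs_filter_topologyE (x : G) (B : set G) :
  nbhs (x : topologize filter_topology) B <-> F [set u | B (x * u)].
Proof.
split=> [[A [oA Ax sAB]]|FB].
  by apply: filterS (oA x Ax) => u; apply: sAB.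
exists [set y | F [set u | B (y * u)]]; split=> //.
- move=> y /(unit_filterM uF)[W FW sW]; apply: filterS (FW) => u Wu.
  by apply: filterS FW => v Wv /=; rewrite -mulgA; apply: sW.
- by move=> y /(unit_filter1 uF) /=; rewrite mulg1.
Qed.

Lemma filter_topology_paratopological : paratopological filter_topology.
Proof.
move=> [x y] B /= /nbhs_filter_topologyE FB.
have [W FW sW] := unit_filterM uF FB.
(* From [(x * u) * (y * v) = (x * y) * (u ^ y * v)]: it suffices that [u ^ y] and [v] lie in [W]. *)
exists ([set z | W ((x^-1 * z) ^ y)], [set z | W (y^-1 * z)]) => /=.
  split; apply/nbhs_filter_topologyE.
    by apply: filterS (unit_filterJ uF y FW) => u; rewrite /= mulKg.
  by apply: filterS FW => u; rewrite /= mulKg.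
move=> [u v] /= [Wu Wv]; have := sW _ _ Wu Wv.
by rewrite /= conjgE !mulgA !mulgK -!mulgA mulVKg.
Qed.

Lemma filter_topology_accessible :
  separated_filter F -> accessible_space (topologize filter_topology).
Proof.
move=> sF x y /eqP xy; exists [set u | u <> y].
split; [|by rewrite inE|by rewrite inE; apply].
move=> z zy /=; have /sF : z^-1 * (y : G) <> 1.
  by move=> /(congr1 (fun w => z * w)); rewrite mulVKg mulg1 => /esym.
by apply: filterS => u uz zu; apply: uz; rewrite -zu mulKg.
Qed.

End FilterTopology.

(* Each [U n.+1] controls only products, the point [h n], and conjugation by
   [h 0], ..., [h n] for an enumeration [h] of [G]: finitely many constraints,
   so that it can still be taken in [F]. *)
Lemma countable_unit_subfilter (G : groupType) (F : set_system G) :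
  countable [set: G] -> unit_filter F -> separated_filter F ->
  exists U : nat -> set G,
    [/\ forall n, F (U n),
        forall m n, (m <= n)%N -> U n `<=` U m,
        unit_filter (filter_from [set: nat] U) &
        separated_filter (filter_from [set: nat] U)].
Proof.
move=> /countable_injP[f injf] uF sF.
have FF := unit_filter_filter uF.
(* A left inverse of the injection [f], with value [1] off its range; [1] is the one point that must
   not be removed. *)
pose h n : G := xget 1 [set g | f g = n].
have hf g : h (f g) = g.
  apply: injf; rewrite ?inE //.
  exact: (@xgetPex _ 1 [set x | f x = f g] (ex_intro _ g erefl)).
(* The premise [F p.2] stands under the quantifier so that [next] is total; outside [F] its value is
   arbitrary. *)
have /choice[next nextP] (p : nat * set G) : exists W, F p.2 ->
    [/\ F W, W `<=` p.2, forall u v, W u -> W v -> p.2 (u * v),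
        forall k : 'I_p.1.+1, W `<=` [set u | p.2 (u ^ h k)] &
        h p.1 <> 1 -> ~ W (h p.1)].
  case: p => n V /=; have [FV|nFV] := pselect (F V); last by exists V.
  have [W FW sW] := unit_filterM uF FV.
  have FJ : F [set u | forall k : 'I_n.+1, V (u ^ h k)].
    by apply: filter_forall => k; apply: unit_filterJ.
  have FN : F [set u | h n <> 1 -> u <> h n].
    have [hn1|hn1] := pselect (h n = 1); first by apply: filterE => u /(_ hn1).
    by apply: filterS (sF _ hn1) => u uh _.
  exists ((V `&` W) `&` ([set u | forall k : 'I_n.+1, V (u ^ h k)] `&`
          [set u | h n <> 1 -> u <> h n])) => _; split.
  - by apply: filterI; apply: filterI.
  - by move=> u [[]].
  - by move=> u v [[_ Wu] _] [[_ Wv] _]; apply: sW.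
  - by move=> k u [_ [uJ _]]; apply: uJ.
  - by move=> hn1 [_ [_ /(_ hn1)]].
pose U := fix U n := if n is m.+1 then next (m, U m) else [set: G].
have FU n : F (U n).
  by elim: n => [|n IH]; [apply: filterT|have [] := nextP (n, U n) IH].
have US n : [/\ U n.+1 `<=` U n, forall u v, U n.+1 u -> U n.+1 v -> U n (u * v),
    forall k : 'I_n.+1, U n.+1 `<=` [set u | U n (u ^ h k)] &
    h n <> 1 -> ~ U n.+1 (h n)].
  by have [] := nextP (n, U n) (FU n).
have Ule m n : (m <= n)%N -> U n `<=` U m.
  move=> /subnK <-; elim: (n - m)%N => // k IH.
  by apply: subset_trans IH; have [] := US (k + m)%N.
exists U; split=> //.
- split.
  + apply: filter_from_filter; first by exists 0%N.
    move=> i j _ _; exists (maxn i j) => // u Uu.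
    by split; apply: Ule Uu; rewrite ?leq_maxl ?leq_maxr.
  + by move=> V [n _ sV]; apply: sV; apply: unit_filter1 uF _ (FU n).
  + move=> V [n _ sV]; exists (U n.+1); first by exists n.+1.
    by move=> u v Uu Uv; apply: sV; have [_ + _ _] := US n; apply.
  (* Conjugation by [x = h (f x)] is controlled only from stage [f x] on; there it sends [U m.+1]
     into [U m], hence into [U n]. *)
  + move=> V x [n _ sV]; pose m := maxn n (f x).
    have km : (f x < m.+1)%N by rewrite ltnS leq_maxr.
    exists m.+1 => // u Um; have [_ _ /(_ (Ordinal km) _ Um)/=] := US m.
    by rewrite hf => Uux _; apply: sV; apply: Ule Uux; apply: leq_maxl.
- move=> x x1; exists (f x).+1 => // u Uu ux.
  by rewrite ux in Uu; have [_ _ _] := US (f x); rewrite hf => /(_ x1).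
Qed.

Theorem theorem6p12 (G : groupType) (countG : countable [set: G]) :
  (exists t : topology_on G,
     [/\ paratopological t,
         accessible_space (topologize t) &
         ~ discrete_space (topologize t)]) <->
  (exists a : nat -> G, PT_sequence a /\ nontrivial_sequence a).
Proof.
split=> [[t [pt T1 nd]]|[a [[t [pt T1 at1]] nta]]].
- have [U [FU Ule uU sU]] := countable_unit_subfilter countG
    (nbhs1_unit_filter pt) (accessible_separated_filter T1).
  have /choice[a aP] n : exists g, U n g /\ g <> 1.
    (* Otherwise [U n] is contained in [[set 1]], which is then a neighbourhood of [1]. *)
    apply: contrapT => /forallNP nU; apply: nd.
    apply: (nbhs1_set1_discrete pt); apply: filterS (FU n) => u Uu.
    by apply: contrapT => u1; apply: (nU u).
  exists a; split.
    exists (filter_topology uU); split.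
    + exact: filter_topology_paratopological.
    + exact: filter_topology_accessible.
    + move=> B /nbhs_filter_topologyE[n _ sB]; exists n => // m /= nm.
      by have := sB _ (Ule _ _ nm _ (aP m).1); rewrite /= mul1g.
  rewrite /nontrivial_sequence (_ : [set n | _] = [set: nat]).
    exact: infinite_nat.
  by apply/seteqP; split=> // n _; have [] := aP n.
(* In a discrete topology [[set 1]] is a neighbourhood of [1], so the convergent sequence is
   eventually [1]. *)
- exists t; split=> // dt; apply: nta.
  have [] := at1 [set 1]; first by apply: open_nbhs_nbhs; split.
  move=> N _ sN; apply: (sub_finite_set _ (finite_II N)) => n /= an1.
  by rewrite ltnNge; apply/negP => /sN.
Qed.
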